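(* Let $0<\mu<L<\infty$, let $f_1,f_2\in\mathcal{F}_{\mu,L}(\mathbb{R}^n)$, let $f=f_1-f_2$, and assume that $f^\star:=\inf_{x\in\mathbb{R}^n}f(x)$ is finite (not necessarily attained). Let $N\ge1$ be an integer, and let $x^1,\dots,x^{N+1}$ be the iterates generated by $N$ iterations of the boosted DCA with backtracking applied to $f=f_1-f_2$, with starting point $x^1\in\mathbb{R}^n$, initial guesses $0<\mu^{(0)}<L^{(0)}$ and backtracking parameter $\beta>1$. Define \[ \bar K:=\max\left\{0,\ \left\lceil\log_\beta\left(\beta L/L^{(0)}\right)\right\rceil,\ \left\lceil\log_\beta\left(\beta\mu^{(0)}/\mu\right)\right\rceil\right\}, \] \[ \bar L:=\beta^{\bar K}\max\{L^{(0)},L\},\quad \bar\mu:=\beta^{-\bar K}\min\{\mu^{(0)},\mu\},\quad \bar\alpha:=\min\left\{2\frac{\bar\mu}{\bar L},1\right\},\quad \bar\kappa:=\frac{\bar\mu}{\bar L}. \] Then, with $g_1^k=\nabla f_1(x^k)$ and $g_2^k=\nabla f_2(x^k)$, \[ \min_{1\le k\le N+1}\frac{\|g_1^k-g_2^k\|^2}{\bar L}\le\frac{f(x^1)-f^\star}{(1+\bar\kappa\bar\alpha)N+\frac{1}{2(1-\bar\kappa)}}. \]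
   Context: For $0\le\mu\le L<\infty$, $\mathcal{F}_{\mu,L}(\mathbb{R}^n)$ denotes the class of functions $h:\mathbb{R}^n\to\mathbb{R}$ such that $x\mapsto h(x)-\frac{\mu}{2}\|x\|^2$ and $x\mapsto\frac{L}{2}\|x\|^2-h(x)$ are both convex, where $\|\cdot\|$ is the Euclidean norm; such functions are convex and differentiable. Boosted DCA (difference-of-convex algorithm) with backtracking for $f=f_1-f_2$. Inputs: starting point $x^1\in\mathbb{R}^n$, number of iterations $N$, estimates $\mu^{(0)},L^{(0)}$ with $0<\mu^{(0)}<L^{(0)}$, and $\beta>1$. For $k=1,\dots,N$: (1) take $g_2^k\in\partial f_2(x^k)$ (here $g_2^k=\nabla f_2(x^k)$); (2) take $y^k\in\operatorname{argmin}_{x\in\mathbb{R}^n}\, f_1(x)-\left(f_2(x^k)+\langle g_2^k,x-x^k\rangle\right)$; (3) set $d^k=y^k-x^k$; (4) set $L^{(k)}\leftarrow L^{(k-1)}$ and $\mu^{(k)}\leftarrow\mu^{(k-1)}$; (5) set $\alpha^{(k)}\leftarrow\min\{2\mu^{(k)}/L^{(k)},1\}$ and $x^{k+1}\leftarrow y^k+\alpha^{(k)}d^k$; (6) while the test inequality \[ f(x^{k+1})+\frac{1}{2L^{(k)}}\|\nabla f_1(x^{k+1})-\nabla f_2(x^{k+1})\|^2+\frac{1}{L^{(k)}}\left[\frac12+\alpha^{(k)}\frac{\mu^{(k)}}{L^{(k)}}\right]\|\nabla f_1(x^k)-\nabla f_2(x^k)\|^2\le f(x^k) \] is not satisfied,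 do: $L^{(k)}\leftarrow\beta L^{(k)}$, $\mu^{(k)}\leftarrow\mu^{(k)}/\beta$, $\alpha^{(k)}\leftarrow\min\{2\mu^{(k)}/L^{(k)},1\}$, $x^{k+1}\leftarrow y^k+\alpha^{(k)}d^k$. *)

(* Defs.v *)
From HB Require Import structures.
From mathcomp Require Import all_boot all_order all_algebra.
From mathcomp Require Import all_classical all_reals all_analysis.
Set Implicit Arguments.
Unset Strict Implicit.
Unset Printing Implicit Defensive.
Import Order.TTheory GRing.Theory Num.Theory.
Import numFieldNormedType.Exports.
Local Open Scope classical_set_scope.
Local Open Scope ring_scope.

Definition dot (R : realType) (n : nat) (u v : 'rV[R]_n) : R :=
  \sum_(j < n) u 0 j * v 0 j.

(* The library norm `|x| on 'rV[R]_n is the sup norm; it induces the same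
   topology, hence the same derivatives. *)
Definition enorm (R : realType) (n : nat) (u : 'rV[R]_n) : R :=
  Num.sqrt (dot u u).

Definition grad (R : realType) (n : nat) (h : 'rV[R]_n -> R)
    (x : 'rV[R]_n) : 'rV[R]_n :=
  \row_(j < n) 'D_(delta_mx 0 j) h x.

(* The class F_{mu,L}(R^n), for 0 <= mu <= L. *)
Definition smooth_convex (R : realType) (n : nat) (mu L : R) :
    set ('rV[R]_n -> R) :=
  [set h |
     convex_function [set: convex_lmodType 'rV[R]_n]
       (fun x : 'rV[R]_n => h x - mu / 2 * enorm x ^+ 2) /\
     convex_function [set: convex_lmodType 'rV[R]_n]
       (fun x : 'rV[R]_n => L / 2 * enorm x ^+ 2 - h x)].

Definition argmin (T : Type) (R : realType) (h : T -> R) : set T :=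
  [set y | forall z, h y <= h z].

Definition dca_model (R : realType) (n : nat) (f1 f2 : 'rV[R]_n -> R)
    (x z : 'rV[R]_n) : R :=
  f1 z - (f2 x + dot (grad f2 x) (z - x)).

Definition stepsize (R : realType) (mu L : R) : R :=
  Num.min (2 * (mu / L)) 1.

Definition boosted_point (R : realType) (n : nat) (x y : 'rV[R]_n)
    (mu L : R) : 'rV[R]_n :=
  y + stepsize mu L *: (y - x).

Definition bdca_test (R : realType) (n : nat) (f1 f2 : 'rV[R]_n -> R)
    (x x' : 'rV[R]_n) (mu L : R) : bool :=
  (f1 x' - f2 x')
    + (2 * L)^-1 * enorm (grad f1 x' - grad f2 x') ^+ 2
    + L^-1 * (2^-1 + stepsize mu L * (mu / L))
        * enorm (grad f1 x - grad f2 x) ^+ 2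
  <= f1 x - f2 x.

(* Big-step semantics of the backtracking while loop:
   [backtracking f1 f2 beta x y mu L mu' L'] holds when the loop entered with
   estimates (mu, L) terminates with estimates (mu', L'). *)
Inductive backtracking (R : realType) (n : nat) (f1 f2 : 'rV[R]_n -> R)
    (beta : R) (x y : 'rV[R]_n) (mu L : R) : R -> R -> Prop :=
| backtracking_stop :
    bdca_test f1 f2 x (boosted_point x y mu L) mu L ->
    backtracking f1 f2 beta x y mu L mu L
| backtracking_loop (mu' L' : R) :
    ~~ bdca_test f1 f2 x (boosted_point x y mu L) mu L ->
    backtracking f1 f2 beta x y (mu / beta) (beta * L) mu' L' ->
    backtracking f1 f2 beta x y mu L mu' L'.

(* One iteration, from (x, mu, L) = (x^k, mu^(k-1), L^(k-1)) to
   (x', mu', L') = (x^(k+1), mu^(k), L^(k)). *)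
Definition bdca_step (R : realType) (n : nat) (f1 f2 : 'rV[R]_n -> R)
    (beta : R) (x : 'rV[R]_n) (mu L : R) (x' : 'rV[R]_n) (mu' L' : R) : Prop :=
  exists y : 'rV[R]_n,
    [/\ argmin (dca_model f1 f2 x) y,
        backtracking f1 f2 beta x y mu L mu' L' &
        x' = boosted_point x y mu' L'].

(* x 1, ..., x N.+1 are iterates of N iterations of the algorithm; the other
   values of the sequence x are irrelevant. *)
Definition bdca_iterates (R : realType) (n : nat) (f1 f2 : 'rV[R]_n -> R)
    (x1 : 'rV[R]_n) (N : nat) (mu0 L0 beta : R) (x : nat -> 'rV[R]_n) : Prop :=
  exists mus Ls : nat -> R,
    [/\ x 1%N = x1, mus 0%N = mu0, Ls 0%N = L0 &
        forall k : nat, (1 <= k <= N)%N ->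
          bdca_step f1 f2 beta (x k) (mus k.-1) (Ls k.-1)
            (x k.+1) (mus k) (Ls k)].

Definition log_base (R : realType) (b a : R) : R := ln a / ln b.

(* Main.v *)
Require Import Defs.
From HB Require Import structures.
From mathcomp Require Import all_boot all_order all_algebra.
From mathcomp Require Import all_classical all_reals all_analysis.
From mathcomp Require Import ring lra.
Import Order.TTheory GRing.Theory Num.Theory.
Import numFieldNormedType.Exports.
Local Open Scope classical_set_scope.
Local Open Scope ring_scope.

(* The while loop scales the estimates to (mu0 / beta^j, beta^j L0). Its test
   is the descent inequality of the boosted DCA step, which holds as soon as
   mu^(k) <= mu and L <= L^(k); hence backtracking stops with j <= Kbar. Every
   accepted test, with the estimates replaced by mubar and Lbar, decreases f by
   at least (1 + kappabar alphabar) times the minimal residual; summing over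
   the N iterations and bounding f(x^(N+1)) - fstar from below by one gradient
   step of the (L - mu)-smooth function f gives the rate.

   The descent inequality is a nonnegative combination of the interpolation
   inequalities of F_{mu,L}: f1 between x^k and y^k and between y^k and x^(k+1)
   (both directions), f2 between x^(k+1) and x^k, and three squared norms; the
   optimality condition grad f1(y^k) = grad f2(x^k) links the two functions. *)

(** * Euclidean inner product *)

Section dot_product.
Context {R : realType} {n : nat}.
Implicit Types (u v w : 'rV[R]_n) (a : R).

Lemma dotC u v : dot u v = dot v u.
Proof. by apply: eq_bigr => j _; rewrite mulrC. Qed.

Lemma dotDl u v w : dot (u + v) w = dot u w + dot v w.
Proof. by rewrite -big_split; apply: eq_bigr => j _; rewrite mxE mulrDl. Qed.

Lemma dotZl a u v : dot (a *: u) v = a * dot u v.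
Proof. by rewrite /dot mulr_sumr; apply: eq_bigr => j _; rewrite mxE mulrA. Qed.

Lemma dotDr u v w : dot u (v + w) = dot u v + dot u w.
Proof. by rewrite dotC dotDl !(dotC _ u). Qed.

Lemma dotZr a u v : dot u (a *: v) = a * dot u v.
Proof. by rewrite dotC dotZl dotC. Qed.

Lemma dotNl u v : dot (- u) v = - dot u v.
Proof. by rewrite -scaleN1r dotZl mulN1r. Qed.

Lemma dotNr u v : dot u (- v) = - dot u v.
Proof. by rewrite dotC dotNl dotC. Qed.

Definition dotE := (dotDl, dotDr, dotZl, dotZr, dotNl, dotNr).

Lemma dot_ge0 u : 0 <= dot u u.
Proof. by apply: sumr_ge0 => j _; rewrite -expr2 sqr_ge0. Qed.

Lemma dot_eq0 u : dot u u <= 0 -> u = 0.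
Proof.
move=> u0; have /eqP : dot u u = 0 by apply/le_anti; rewrite u0 dot_ge0.
rewrite psumr_eq0 => [|j _]; last by rewrite -expr2 sqr_ge0.
move=> /allP uj; apply/rowP => j; rewrite mxE.
by have := uj j (mem_index_enum j); rewrite mulf_eq0 orbb => /eqP.
Qed.

Lemma enorm_sqr u : enorm u ^+ 2 = dot u u.
Proof. by rewrite sqr_sqrtr// dot_ge0. Qed.

End dot_product.

(** * Limits at zero in quantitative form *)

Section small_parameter.
Context {R : realType}.
Implicit Types a K : R.

Lemma ler0_small a K : (forall t, 0 < t <= 1 -> a <= K * t) -> a <= 0.
Proof.
move=> aK; rewrite leNgt; apply/negP => a0.
have K0 : 0 <= `|K| by [].
have KK : K <= `|K| by exact: ler_norm.
have D0 : 0 < `|K| + a + 1 by lra.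
(* This [t] lies in (0, 1] and gives [K * t < a / 2], against [a <= K * t]. *)
set t := (2 * (`|K| + a + 1))^-1 * a.
have t0 : 0 < t by rewrite mulr_gt0// invr_gt0; lra.
have tE : 2 * (`|K| + a + 1) * t = a.
  by rewrite /t mulrA divff ?mul1r//; apply: lt0r_neq0; lra.
have t1 : t <= 1 by nra.
have := aK t; rewrite t0 t1 => /(_ isT) H.
nra.
Qed.

(** Positive [t] bounds [a] by [K * t], negative [t] does the same for [- a]. *)
Lemma eq0_small a K : (forall t, t * a <= K * t ^+ 2) -> a = 0.
Proof.
move=> aK; apply/le_anti/andP; split.
  by apply: (@ler0_small _ K) => t /andP[t0 _]; have := aK t; nra.
rewrite -oppr_le0; apply: (@ler0_small _ K) => t /andP[t0 _].
by have := aK (- t); nra.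
Qed.

End small_parameter.

(** * Differentiability along lines from the two convexity conditions *)

Section convexity_inequalities.
Context {R : realType} {n : nat}.
Variables (mu L : R) (h : 'rV[R]_n -> R).
Hypothesis hh : smooth_convex mu L h.
Implicit Types (u v w x y : 'rV[R]_n) (t : R).

(** The quadratic terms of the convexity condition combine by t|u|^2 + (1-t)|v|^2 - |tu + (1-t)v|^2
    = t(1-t)|u-v|^2. *)
Lemma smooth_convex_lower t u v : 0 <= t <= 1 ->
  h (t *: u + (1 - t) *: v) <=
  t * h u + (1 - t) * h v - mu / 2 * (t * (1 - t)) * dot (u - v) (u - v).
Proof.
move=> t01; have [+ _] := hh.
move=> /(_ (Itv01 (proj1 (andP t01)) (proj2 (andP t01))) u v).
rewrite !inE => /(_ I I).
rewrite convRE !enorm_sqr [X in h X](_ : _ = t *: u + (1 - t) *: v)//=.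
rewrite [X in dot X X](_ : _ = t *: u + (1 - t) *: v)//.
rewrite /unstable.onem !dotE (dotC v u) => H; nra.
Qed.

Lemma smooth_convex_upper t u v : 0 <= t <= 1 ->
  t * h u + (1 - t) * h v - L / 2 * (t * (1 - t)) * dot (u - v) (u - v)
  <= h (t *: u + (1 - t) *: v).
Proof.
move=> t01; have [_ +] := hh.
move=> /(_ (Itv01 (proj1 (andP t01)) (proj2 (andP t01))) u v).
rewrite !inE => /(_ I I).
rewrite convRE !enorm_sqr [X in h X](_ : _ = t *: u + (1 - t) *: v)//=.
rewrite [X in dot X X](_ : _ = t *: u + (1 - t) *: v)//.
rewrite /unstable.onem !dotE (dotC v u) => H; nra.
Qed.

End convexity_inequalities.

(* Convexity of psi and of c t^2 - psi makes the slopes (psi t - psi 0) / t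
   monotone and c-Lipschitz on t <> 0, across 0 included, so the derivative at 0
   exists with a quadratic error. *)
Section slopes.
Context {R : realType}.
Variables (c : R) (psi : R -> R).
Hypothesis psi_lower : forall t a b, 0 <= t <= 1 ->
  psi (t * a + (1 - t) * b) <= t * psi a + (1 - t) * psi b.
Hypothesis psi_upper : forall t a b, 0 <= t <= 1 ->
  t * psi a + (1 - t) * psi b - c * (t * (1 - t)) * (a - b) ^+ 2
  <= psi (t * a + (1 - t) * b).

(** Both hypotheses at [q], seen as a convex combination of [p] and [r], multiplied by [r - p] to
    clear denominators. *)
Let three_points p q r : p < q -> q < r ->
  0 <= (r - q) * psi p + (q - p) * psi r - (r - p) * psi q
    <= c * ((r - q) * (q - p) * (r - p)).
Proof.
move=> pq qr; have rp : 0 < r - p by lra.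
have rp0 : r - p != 0 by apply: lt0r_neq0.
pose t := (r - q) / (r - p).
have tE : t * (r - p) = r - q by rewrite /t mulfVK.
have t01 : 0 <= t <= 1 by apply/andP; split; nra.
have qE : t * p + (1 - t) * r = q.
  by transitivity (r - t * (r - p)); [ring | rewrite tE; ring].
have lo := psi_lower t p r t01; have hi := psi_upper t p r t01.
rewrite {}qE in lo hi.
rewrite -tE.
have -> : q - p = (1 - t) * (r - p) by rewrite mulrBl tE; ring.
rewrite (_ : t * (r - p) * psi p + (1 - t) * (r - p) * psi r - (r - p) * psi q
  = (r - p) * (t * psi p + (1 - t) * psi r - psi q)); last by ring.
rewrite (_ : c * (t * (r - p) * ((1 - t) * (r - p)) * (r - p))
  = (r - p) * (c * (t * (1 - t)) * (p - r) ^+ 2)); last by ring.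
rewrite (ler_pM2l rp); apply/andP; split; last by lra.
by apply: mulr_ge0; lra.
Qed.

Let slope t := (psi t - psi 0) / t.

Let slopeE t : t != 0 -> psi t = psi 0 + t * slope t.
Proof. by move=> t0; rewrite /slope; field. Qed.

(** [three_points] for [a], [b] and [0] in increasing order, divided by |ab|. *)
Let slope_lipschitz a b : a != 0 -> b != 0 -> a < b ->
  0 <= slope b - slope a <= c * (b - a).
Proof.
move=> a0 b0 ab.
have [a_lt0|a_gt0|aE] := ltgtP a 0; last by rewrite aE eqxx in a0.
- have [b_lt0|b_gt0|bE] := ltgtP b 0; last by rewrite bE eqxx in b0.
  + have := three_points a b 0 ab b_lt0.
    rewrite (slopeE _ a0) (slopeE _ b0) => /andP[H1 H2].
    have ab0 : 0 < a * b by nra.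
    apply/andP; split; last by rewrite -(ler_pM2l ab0); lra.
    by rewrite -(pmulr_rge0 _ ab0); lra.
  + have := three_points a 0 b a_lt0 b_gt0.
    rewrite (slopeE _ a0) (slopeE _ b0) => /andP[H1 H2].
    have ab0 : 0 < - a * b by nra.
    apply/andP; split; last by rewrite -(ler_pM2l ab0); lra.
    by rewrite -(pmulr_rge0 _ ab0); lra.
- have b_gt0 : 0 < b by lra.
  have := three_points 0 a b a_gt0 ab.
  rewrite (slopeE _ a0) (slopeE _ b0) => /andP[H1 H2].
  have ab0 : 0 < a * b by nra.
  apply/andP; split; last by rewrite -(ler_pM2l ab0); lra.
  by rewrite -(pmulr_rge0 _ ab0); lra.
Qed.

Lemma derivative_expansion :
  exists D, forall t, `|psi t - psi 0 - t * D| <= 2 * c * t ^+ 2.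
Proof.
(* The derivative will be the right derivative [inf S]; slopes at negative points are lower bounds
   of [S]. *)
pose S := [set slope t | t in [set t | 0 < t]].
have lb_neg a : a < 0 -> lbound S (slope a).
  move=> a0 _ [t t0 <-].
  have := slope_lipschitz a t; rewrite lt_eqF ?gt_eqF // (lt_trans a0 t0).
  by move=> /(_ isT isT isT); lra.
have S0 : S !=set0 by exists (slope 1), 1 => //=.
have hS : has_inf S by split=> //; exists (slope (-1)); apply: lb_neg; lra.
exists (inf S) => t.
have c0 : 0 <= c.
  have lt12 : 1 < 2 :> R by lra.
  have := slope_lipschitz 1 2; rewrite !gt_eqF // => /(_ isT isT lt12); lra.
(* Comparison of [a] with [- a], at distance [2 * a]: the origin of the factor 2 in the error. *)
have main a : 0 < a -> slope a - 2 * c * a <= inf S <= slope a.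
  move=> a0; apply/andP; split.
    apply: (le_trans _ (lb_le_inf S0 (lb_neg (- a) _))); last by lra.
    have := slope_lipschitz (- a) a.
    rewrite lt_eqF ?gt_eqF //; last by lra.
    by rewrite (_ : - a < a); [move=> /(_ isT isT isT); lra | lra].
  by apply: ge_inf; [case: hS | exists a].
have [t0|t0|->] := ltgtP t 0;
  last by rewrite subrr mul0r subrr normr0 expr0n mulr0.
- have nt0 : 0 < - t by lra.
  have := main _ nt0 => /andP[_ M2].
  have M1 := lb_le_inf S0 (lb_neg _ t0).
  have := slope_lipschitz t (- t).
  rewrite lt_eqF ?gt_eqF // (_ : t < - t); last by lra.
  move=> /(_ isT isT isT) /andP[_ M3].
  rewrite (slopeE t) ?lt_eqF //.
  rewrite (_ : _ - _ - _ = t * (slope t - inf S)); last by ring.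
  rewrite normrM (ltr0_norm t0) ler0_norm; last by lra.
  rewrite (_ : 2 * c * t ^+ 2 = - t * (c * (- t - t))); last by ring.
  by rewrite (ler_pM2l nt0); lra.
- have := main _ t0 => /andP[M1 M2].
  rewrite (slopeE t) ?gt_eqF //.
  rewrite (_ : _ - _ - _ = t * (slope t - inf S)); last by ring.
  rewrite normrM (gtr0_norm t0) ger0_norm; last by lra.
  rewrite (_ : 2 * c * t ^+ 2 = t * (2 * c * t)); last by ring.
  by rewrite (ler_pM2l t0); lra.
Qed.

End slopes.

(** After division by [t], the difference quotient is within C|t| of [D]. *)
Lemma derive_of_expansion (R : realType) (n : nat) (h : 'rV[R]_n -> R)
    (x v : 'rV[R]_n) (D C : R) :
  (forall t, `|h (x + t *: v) - h x - t * D| <= C * t ^+ 2) -> 'D_v h x = D.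
Proof.
move=> hD; apply/cvg_lim => //; apply/cvgrPdist_le => e e0.
have C0 : 0 <= C by have := hD 1; rewrite expr1n mulr1; apply: le_trans.
near=> t.
have t0 : t != 0 by near: t; exact: nbhs_dnbhs_neq.
(* The [+ 1] covers the case [C = 0]. *)
have te : `|t| <= e / (C + 1).
  near: t; apply: dnbhs0_le; rewrite divr_gt0//; lra.
rewrite /= [t *: v + x]addrC -[t^-1 *: _]/(t^-1 * (h (x + t *: v) - h x)).
have := hD t; set delta := h _ - _ => hDt.
rewrite (_ : D - _ = - (t^-1 * (delta - t * D))); last by field.
rewrite normrN normrM normfV ler_pdivrMl ?normr_gt0//.
apply: (le_trans hDt); rewrite -real_normK ?num_real// expr2.
rewrite mulrCA ler_pM2l ?normr_gt0//.
apply: (le_trans (ler_wpM2l C0 te)).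
by rewrite mulrCA ger_pMr// ler_pdivrMr; lra.
Unshelve. all: by end_near.
Qed.

(** * Gradient and two-sided quadratic bounds *)

Section gradient.
Context {R : realType} {n : nat}.
Variables (mu L : R) (h : 'rV[R]_n -> R).
Hypotheses (mu_ge0 : 0 <= mu) (hh : smooth_convex mu L h).
Implicit Types (u v w x y : 'rV[R]_n) (t : R).

(** The restriction of [h] to the line through [x] along [v] meets the hypotheses on [psi], with
    [c = L / 2 * dot v v]. *)
Lemma smooth_convex_expansion x v :
  exists C, forall t, `|h (x + t *: v) - h x - t * 'D_v h x| <= C * t ^+ 2.
Proof.
pose psi t := h (x + t *: v).
have psiE t a b : x + (t * a + (1 - t) * b) *: v
    = t *: (x + a *: v) + (1 - t) *: (x + b *: v).
  rewrite !scalerDr !scalerA addrACA -!scalerDl.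
  by rewrite (addrC t) subrK scale1r.
have psiB a b : dot (x + a *: v - (x + b *: v)) (x + a *: v - (x + b *: v))
    = dot v v * (a - b) ^+ 2.
  by rewrite opprD addrACA subrr add0r -scalerBl !dotE; ring.
have lo t a b : 0 <= t <= 1 ->
    psi (t * a + (1 - t) * b) <= t * psi a + (1 - t) * psi b.
  move=> t01; rewrite /psi psiE.
  have := smooth_convex_lower _ _ _ hh t (x + a *: v) (x + b *: v) t01.
  rewrite psiB => H.
  have : 0 <= mu * (t * (1 - t)) * (dot v v * (a - b) ^+ 2).
    case/andP: t01 => t0 t1.
    apply: mulr_ge0; last by rewrite mulr_ge0 ?dot_ge0 ?sqr_ge0.
    by rewrite !mulr_ge0 // subr_ge0.
  lra.
have hi t a b : 0 <= t <= 1 ->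
    t * psi a + (1 - t) * psi b
      - (L / 2 * dot v v) * (t * (1 - t)) * (a - b) ^+ 2
    <= psi (t * a + (1 - t) * b).
  move=> t01; rewrite /psi psiE.
  have := smooth_convex_upper _ _ _ hh t (x + a *: v) (x + b *: v) t01.
  rewrite psiB; lra.
have [D] := derivative_expansion _ _ lo hi.
rewrite /psi scale0r addr0 => HD.
exists (2 * (L / 2 * dot v v)).
by rewrite (derive_of_expansion _ _ _ _ _ _ _ HD).
Qed.

(* The midpoint inequality along [u] and [w], used with both signs of [t], gives
   additivity of the directional derivative. *)
Lemma smooth_convex_derive_linear x v : 'D_v h x = dot (grad h x) v.
Proof.
have DZ a w : 'D_(a *: w) h x = a * 'D_w h x.
  have [C HC] := smooth_convex_expansion x w.
  apply: (@derive_of_expansion _ _ _ _ _ _ (C * a ^+ 2)) => t.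
  rewrite scalerA mulrA (_ : C * _ * _ = C * (t * a) ^+ 2); last by ring.
  exact: HC.
have DD u w : 'D_(u + w) h x = 'D_u h x + 'D_w h x.
  have [Cu Hu] := smooth_convex_expansion x u.
  have [Cw Hw] := smooth_convex_expansion x w.
  have [C HC] := smooth_convex_expansion x (u + w).
  apply/eqP; rewrite -subr_eq0; apply/eqP.
  apply: (@eq0_small _ _ (C + 2 * Cu + 2 * Cw)) => t.
  have mid : x + t *: (u + w)
      = 2^-1 *: (x + (2 * t) *: u) + (1 - 2^-1) *: (x + (2 * t) *: w).
    by apply/rowP => j; rewrite !mxE; field.
  have half : 0 <= (2^-1 : R) <= 1 by lra.
  have := smooth_convex_lower _ _ _ hh _
    (x + (2 * t) *: u) (x + (2 * t) *: w) half.
  rewrite -mid.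
  have : 0 <= mu * dot (x + (2 * t) *: u - (x + (2 * t) *: w))
     (x + (2 * t) *: u - (x + (2 * t) *: w)) by rewrite mulr_ge0 ?dot_ge0.
  have := HC t; have := Hu (2 * t); have := Hw (2 * t).
  rewrite !ler_norml => /andP[_ W] /andP[_ U] /andP[UW _].
  lra.
rewrite {1}[v]row_sum_delta /dot.
rewrite (big_morph (fun w => 'D_w h x) (id1 := 0) (op1 := +%R)) //.
  by apply: eq_bigr => j _; rewrite DZ mxE mulrC.
by have := DZ 0 0; rewrite scale0r mul0r.
Qed.

(** Strong convexity at [x + t *: v], with [h] there replaced by its expansion, is divided by [t];
    the remaining error is linear in [t], so [ler0_small] removes it. *)
Lemma smooth_convex_grad_lower x z :
  h x + dot (grad h x) (z - x) + mu / 2 * dot (z - x) (z - x) <= h z.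
Proof.
set v := z - x; have zE : z = x + v by rewrite /v addrC subrK.
have [C] := smooth_convex_expansion x v.
rewrite smooth_convex_derive_linear => HC.
rewrite -subr_le0; apply: (@ler0_small _ _ (C + mu / 2 * dot v v)) => t.
move=> /andP[t0 t1].
have t01 : 0 <= t <= 1 by rewrite t1 ltW.
have := smooth_convex_lower _ _ _ hh _ z x t01; rewrite -/v.
rewrite (_ : t *: z + (1 - t) *: x = x + t *: v); last first.
  by apply/rowP => j; rewrite zE !mxE; ring.
have := HC t; rewrite ler_norml => /andP[H _] K.
by rewrite -(ler_pM2l t0); lra.
Qed.

Lemma smooth_convex_grad_upper x z :
  h z <= h x + dot (grad h x) (z - x) + L / 2 * dot (z - x) (z - x).
Proof.
set v := z - x; have zE : z = x + v by rewrite /v addrC subrK.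
have [C] := smooth_convex_expansion x v.
rewrite smooth_convex_derive_linear => HC.
rewrite -subr_le0; apply: (@ler0_small _ _ (C - L / 2 * dot v v)) => t.
move=> /andP[t0 t1].
have t01 : 0 <= t <= 1 by rewrite t1 ltW.
have := smooth_convex_upper _ _ _ hh _ z x t01; rewrite -/v.
rewrite (_ : t *: z + (1 - t) *: x = x + t *: v); last first.
  by apply/rowP => j; rewrite zE !mxE; ring.
have := HC t; rewrite ler_norml => /andP[_ H] K.
by rewrite -(ler_pM2l t0); lra.
Qed.

End gradient.

(** * Descent inequality for one boosted step *)

Definition quad_bounds {R : realType} {n : nat} (mu L : R)
    (h : 'rV[R]_n -> R) :=
  forall x z,
    h x + dot (grad h x) (z - x) + mu / 2 * dot (z - x) (z - x) <= h z
    <= h x + dot (grad h x) (z - x) + L / 2 * dot (z - x) (z - x).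

(** The analysis of the algorithm sees F_{mu,L} only through these bounds. *)
Lemma smooth_convex_quad_bounds (R : realType) (n : nat) (mu L : R)
    (h : 'rV[R]_n -> R) :
  0 <= mu -> smooth_convex mu L h -> quad_bounds mu L h.
Proof.
move=> mu0 hh x z; apply/andP; split.
  exact: (smooth_convex_grad_lower _ _ _ mu0 hh).
exact: (smooth_convex_grad_upper _ _ _ mu0 hh).
Qed.

(* The scalars stand for the inner products of d = y - x,
   G = grad f1 x - grad f2 x, p = grad f1 x' - grad f2 x and
   q = grad f2 x' - grad f2 x, with w = <grad f2 x, d>. The multipliers are
   forced by tightness at G = - L d, p = a mu d, q = (L + a mu) d, where the
   last three hypotheses (squared norms) vanish. *)
Lemma boosted_descent_scalar (R : realType) (mu L a : R)
    (F1x F1y F1x' F2x F2x' w dd dG dp dq GG pp qq pq : R) :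
  0 < mu -> mu < L -> 0 < a -> a <= 1 -> a * L <= 2 * mu ->
  GG + mu * L * dd + 2 * mu * dG <= 2 * (L - mu) * (F1x - F1y + w) ->
  GG + mu * L * dd + 2 * mu * dG <= 2 * (L - mu) * (F1y - F1x - (w + dG)) ->
  pp + mu * L * (a ^+ 2 * dd) - 2 * mu * (a * dp)
    <= 2 * (L - mu) * (F1y - F1x' + a * (w + dp)) ->
  pp + mu * L * (a ^+ 2 * dd) - 2 * mu * (a * dp)
    <= 2 * (L - mu) * (F1x' - F1y - a * w) ->
  qq + mu * L * ((1 + a) ^+ 2 * dd) - 2 * mu * ((1 + a) * dq)
    <= 2 * (L - mu) * (F2x' - F2x - (1 + a) * w) ->
  0 <= pp - 2 * (a * mu) * dp + (a * mu) ^+ 2 * dd ->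
  0 <= mu ^+ 2 * (qq - 2 * ((1 + a) * L) * dq + ((1 + a) * L) ^+ 2 * dd)
       + 2 * mu * (L - mu) * (pq - (1 + a) * L * dp) + (L - mu) ^+ 2 * pp ->
  0 <= GG + 2 * L * dG + L ^+ 2 * dd ->
  F1x' - F2x' + (2 * L)^-1 * (pp - 2 * pq + qq)
    + L^-1 * (2^-1 + a * (mu / L)) * GG <= F1x - F2x.
Proof.
move=> mu0 muL a0 a1 aL I1 I1' I2 I2' I3 S1 S2 S3.
rewrite -subr_ge0 in I1; rewrite -subr_ge0 in I1'; rewrite -subr_ge0 in I2.
rewrite -subr_ge0 in I2'; rewrite -subr_ge0 in I3; rewrite -subr_ge0.
have L0 : 0 < L by lra.
have Lm0 : 0 < L - mu by lra.
(* Multipliers of the hypotheses. The step bounds enter through [c2], which vanishes at [a = 1], and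
   [c3], which vanishes at [a * L = 2 * mu]. *)
have cI : 0 <= (2 * (L - mu))^-1 by rewrite invr_ge0; lra.
have c1 : 0 <= a * mu / (L * (L - mu)).
  by rewrite divr_ge0 ?mulr_ge0 ?ltW// mulr_gt0.
have c2 : 0 <= (1 - a) / (2 * a * (L - mu)).
  by rewrite divr_ge0 ?subr_ge0// !mulr_ge0 ?ltW.
have c3 : 0 <= (2 * mu - a * L) / (2 * mu * a * (L - mu)).
  by rewrite divr_ge0 ?subr_ge0// !mulr_ge0 ?ltW.
have c4 : 0 <= (2 * L * mu * (L - mu))^-1.
  by rewrite invr_ge0 !mulr_ge0 ?ltW.
have c5 : 0 <= mu / (2 * L * (L - mu))
    + a * mu / (L ^+ 2 * (L - mu)) * (L + mu).
  apply: addr_ge0; first by rewrite divr_ge0 ?mulr_ge0 ?ltW.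
  apply: mulr_ge0; last by lra.
  by apply: divr_ge0; rewrite mulr_ge0 ?sqr_ge0 ?ltW.
(* The weighted sum of the hypotheses equals the required gap identically, so [field] closes the
   goal. *)
apply: (le_trans (addr_ge0 (addr_ge0 (addr_ge0 (addr_ge0 (addr_ge0
  (mulr_ge0 cI (addr_ge0 (addr_ge0 I1 I2) I3)) (mulr_ge0 c1 (addr_ge0 I1 I1')))
  (mulr_ge0 c2 (addr_ge0 I2 I2'))) (mulr_ge0 c3 S1)) (mulr_ge0 c4 S2))
  (mulr_ge0 c5 S3))).
rewrite le_eqVlt; apply/orP; left; apply/eqP; field.
by rewrite !lt0r_neq0.
Qed.

Section descent.
Context {R : realType} {n : nat}.
Implicit Types (u v w x y : 'rV[R]_n) (t : R).

(** [h] lies above its lower model at [y] and below its upper model at [x]; comparing the two models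
    at one well-chosen point brings in the gradient difference. *)
Lemma interpolation (mu L : R) (h : 'rV[R]_n -> R) x y :
  mu < L -> quad_bounds mu L h ->
  dot (grad h x - grad h y) (grad h x - grad h y)
    + mu * L * dot (x - y) (x - y) - 2 * mu * dot (grad h x - grad h y) (x - y)
  <= 2 * (L - mu) * (h x - h y - dot (grad h y) (x - y)).
Proof.
move=> muL hh; set dx := x - y; set dg := grad h x - grad h y.
have Lm0 : 0 < L - mu by lra.
have cN0 : L - mu != 0 by apply: lt0r_neq0.
pose c := (L - mu)^-1.
(* [x + w] minimizes the gap between the upper bound at [x] and the lower bound
   at [y]. *)
pose w := c *: (mu *: dx - dg).
have z_up := proj2 (andP (hh x (x + w))).
have z_lo := proj1 (andP (hh y (x + w))).
have E1 : x + w - x = w by rewrite addrC addKr.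
have E2 : x + w - y = dx + w by rewrite /dx addrAC.
rewrite E1 in z_up; rewrite E2 in z_lo.
have gE : grad h x = grad h y + dg by rewrite /dg addrC subrK.
rewrite gE in z_up.
have {z_lo z_up} := le_trans z_lo z_up.
clear E1 E2 gE; rewrite {}/w; clearbody dx dg.
rewrite !dotE (dotC dx dg) -subr_ge0 => H.
rewrite -subr_ge0; have c2 : 0 <= 2 * (L - mu) by lra.
apply: (le_trans (mulr_ge0 c2 H)); rewrite le_eqVlt; apply/orP; left.
by apply/eqP; rewrite /c; field.
Qed.

Lemma stepsize_itv (mu L : R) : 0 < mu -> 0 < L ->
  [/\ 0 < stepsize mu L, stepsize mu L <= 1 & stepsize mu L * L <= 2 * mu].
Proof.
move=> mu0 L0; have k0 : 0 < mu / L by rewrite divr_gt0.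
rewrite /stepsize; split; first by rewrite lt_min ltr01 andbT mulr_gt0.
  by rewrite ge_min lexx orbT.
by rewrite -ler_pdivlMr// -mulrA ge_min lexx.
Qed.

(** All displacements are multiples of [d], and by optimality of [y] all gradients are offsets [0],
    [G], [p], [q] from [grad f2 x]; this reduces the test to [boosted_descent_scalar]. *)
Lemma boosted_dca_descent (mu L : R) (f1 f2 : 'rV[R]_n -> R) x y :
  0 < mu -> mu < L -> quad_bounds mu L f1 -> quad_bounds mu L f2 ->
  grad f1 y = grad f2 x ->
  bdca_test f1 f2 x (boosted_point x y mu L) mu L.
Proof.
move=> mu0 muL hf1 hf2 gy.
have [a0 a1 aL] := stepsize_itv mu L mu0 (lt_trans mu0 muL).
rewrite /bdca_test !enorm_sqr /boosted_point.
set x' := y + _; move: a0 a1 aL @x'.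
move: (stepsize mu L) => a a0 a1 aL x'.
have I1 := interpolation mu L f1 x y muL hf1.
have I1' := interpolation mu L f1 y x muL hf1.
have I2 := interpolation mu L f1 y x' muL hf1.
have I2' := interpolation mu L f1 x' y muL hf1.
have I3 := interpolation mu L f2 x' x muL hf2.
have [d dE] : exists d, y - x = d by exists (y - x).
have xd : x - y = - d by rewrite -dE opprB.
have yx' : y - x' = - (a *: d) by rewrite /x' dE opprD addNKr.
have x'y : x' - y = a *: d by rewrite -opprB yx' opprK.
have x'x : x' - x = (1 + a) *: d.
  by rewrite -[x'](subrK y) x'y -addrA dE scalerDl scale1r addrC.
move: I1 I1' I2 I2' I3; rewrite dE xd yx' x'y x'x gy.
have [G GE] : exists G, grad f1 x = grad f2 x + G.
  by exists (grad f1 x - grad f2 x); rewrite addrC subrK.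
have [p pE] : exists p, grad f1 x' = grad f2 x + p.
  by exists (grad f1 x' - grad f2 x); rewrite addrC subrK.
have [q qE] : exists q, grad f2 x' = grad f2 x + q.
  by exists (grad f2 x' - grad f2 x); rewrite addrC subrK.
have KG u v : u + v - u = v by rewrite addrC addKr.
have NKG u v : u - (u + v) = - v by rewrite opprD addNKr.
have pqE u v w : u + v - (u + w) = v - w by rewrite opprD addrACA subrr add0r.
rewrite GE pE qE !(KG, NKG, pqE).
clear dE xd yx' x'y x'x gy GE pE qE; clearbody x'.
have S1 := dot_ge0 (p - (a * mu) *: d).
have S2 := dot_ge0 (mu *: (q - ((1 + a) * L) *: d) + (L - mu) *: p).
have S3 := dot_ge0 (G + L *: d).
move: S1 S2 S3; rewrite !dotE (dotC p d) (dotC q d) (dotC G d) (dotC q p).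
move=> S1 S2 S3 I1 I1' I2 I2' I3.
have := @boosted_descent_scalar R mu L a (f1 x) (f1 y) (f1 x') (f2 x) (f2 x')
  (dot (grad f2 x) d) (dot d d) (dot d G) (dot d p) (dot d q) (dot G G)
  (dot p p) (dot q q) (dot p q) mu0 muL a0 a1 aL.
rewrite (_ : dot p p - 2 * dot p q + dot q q
  = dot p p - dot p q + (- dot p q - - dot q q)); last by ring.
apply; lra.
Qed.

(** A gradient step of length 1/L from [y] would lower the model by at least |r|^2/(2L), where [r]
    is the gradient residual. *)
Lemma argmin_dca_model_grad (mu L : R) (f1 f2 : 'rV[R]_n -> R) x y :
  0 < L -> quad_bounds mu L f1 ->
  argmin (dca_model f1 f2 x) y -> grad f1 y = grad f2 x.
Proof.
move=> L0 hf1 hy; apply/eqP; rewrite -subr_eq0; apply/eqP/dot_eq0.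
have [r rE] : exists r, grad f1 y - grad f2 x = r by eexists.
have gE : grad f1 y = grad f2 x + r by rewrite -rE addrC subrK.
rewrite rE; have := hy (y - L^-1 *: r); rewrite /dca_model => H.
have /andP[_] := hf1 y (y - L^-1 *: r).
rewrite (_ : y - L^-1 *: r - y = - (L^-1 *: r)); last by rewrite addrC addKr.
move: H; rewrite gE !dotE.
have LL : L * (L^-1 * (L^-1 * dot r r)) = L^-1 * dot r r.
  by rewrite mulVKf// lt0r_neq0.
move=> H1 H2; rewrite -(pmulr_rle0 (dot r r) (_ : 0 < L^-1)) ?invr_gt0//; lra.
Qed.

End descent.

(** * Backtracking and the range of the estimates *)

Section bdca.
Context {R : realType} {n : nat}.
Variables (mu L beta : R) (f1 f2 : 'rV[R]_n -> R).
Hypotheses (hmu : 0 < mu) (hmuL : mu < L) (hbeta : 1 < beta).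
Hypotheses (hf1 : quad_bounds mu L f1) (hf2 : quad_bounds mu L f2).
Implicit Types (x y : 'rV[R]_n) (m l : R) (j k : nat).

Lemma quad_boundsW m l (h : 'rV[R]_n -> R) :
  m <= mu -> L <= l -> quad_bounds mu L h -> quad_bounds m l h.
Proof.
move=> mmu Ll hh x z; have /andP[lo up] := hh x z.
have := ler_wpM2r (dot_ge0 (z - x)) mmu.
have := ler_wpM2r (dot_ge0 (z - x)) Ll.
by move=> ? ?; apply/andP; split; lra.
Qed.

(* If the loop ran at least once, the test failed one round before the end, when
   the estimates were [beta * m'] and [l' / beta]. *)
Lemma backtracking_scaling x y m l m' l' :
  argmin (dca_model f1 f2 x) y -> backtracking f1 f2 beta x y m l m' l' ->
  0 < m -> m < l ->
  bdca_test f1 f2 x (boosted_point x y m' l') m' l' /\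
  exists j, [/\ m' = m / beta ^+ j, l' = beta ^+ j * l &
    j = 0%N \/ (l' < beta * L \/ mu < beta * m')].
Proof.
move=> hy; have b0 : 0 < beta := lt_trans ltr01 hbeta.
have bn0 : beta != 0 by apply: lt0r_neq0.
elim=> {m l m' l'} [m l test m0 ml|m l m' l' fails _ IH m0 ml].
  by split=> //; exists 0%N; rewrite expr0 divr1 mul1r; split=> //; left.
have [||test [j [mE lE jE]]] := IH; first by rewrite divr_gt0.
  have b1 := hbeta; have bl : l < beta * l by nra.
  by rewrite ltr_pdivrMr//; nra.
split=> //; exists j.+1; split.
- by rewrite mE exprS; field; rewrite bn0 expf_neq0.
- by rewrite lE exprS; ring.
(* Either a later round also failed, or [j = 0] and the present failure is the last one. *)
right; case: jE => [j0|//]; move: mE lE; rewrite j0 expr0 divr1 mul1r => -> ->.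
rewrite ltr_pM2l// mulrCA divff// mulr1.
have [lL|Ll] := ltP l L; first by left.
have [|mmu] := ltP mu m; first by right.
(* Now [m <= mu] and [L <= l], so the bounds hold with [(m, l)] and the failed test should have
   succeeded. *)
move/negP: fails; case; apply: boosted_dca_descent => //.
- exact: quad_boundsW.
- exact: quad_boundsW.
- exact: (argmin_dca_model_grad mu L _ _ _ _ (lt_trans hmu hmuL)).
Qed.

(** Estimates are inherited between iterations, so exponents add up; an iteration without
    backtracking passes the alternative on unchanged. *)
Lemma bdca_estimates_scaling N mu0 L0 (x : nat -> 'rV[R]_n)
    (mus Ls : nat -> R) :
  0 < mu0 -> mu0 < L0 -> mus 0%N = mu0 -> Ls 0%N = L0 ->
  (forall k, (1 <= k <= N)%N ->
    bdca_step f1 f2 beta (x k) (mus k.-1) (Ls k.-1) (x k.+1) (mus k) (Ls k)) ->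
  forall k, (k <= N)%N -> exists j,
    [/\ mus k = mu0 / beta ^+ j, Ls k = beta ^+ j * L0,
        j = 0%N \/ (Ls k < beta * L \/ mu < beta * mus k) &
        (0 < k)%N -> bdca_test f1 f2 (x k) (x k.+1) (mus k) (Ls k)].
Proof.
move=> mu0_gt0 muL0 mus0 Ls0 hstep; have b0 : 0 < beta := lt_trans ltr01 hbeta.
elim=> [_|k IH kN].
  by exists 0%N; rewrite expr0 divr1 mul1r; split=> //; left.
have [j [mE lE jE _]] := IH (ltnW kN).
have [y [hy bt xE]] := hstep k.+1 kN.
have bj : 1 <= beta ^+ j by rewrite exprn_ege1// ltW.
have bj0 : 0 < beta ^+ j by lra.
have m0 : 0 < mus k by rewrite mE divr_gt0.
have ml : mus k < Ls k.
  rewrite mE lE ltr_pdivrMr//; apply: (lt_le_trans muL0).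
  by rewrite mulrAC ler_peMl ?mulr_ege1//; lra.
have [test [i [mE' lE' iE]]] := backtracking_scaling _ _ _ _ _ _ hy bt m0 ml.
exists (i + j)%N; split; last by rewrite xE.
- by rewrite mE' mE exprD; field; rewrite !expf_neq0 ?lt0r_neq0.
- by rewrite lE' lE exprD mulrA.
case: iE => [i0|]; last by right.
by move: mE' lE'; rewrite i0 add0n expr0 divr1 mul1r /= => -> ->.
Qed.

End bdca.

(** * Exponent bound and convergence rate *)

Lemma expr_le_ceil_log (R : realType) (b c : R) (j : nat) :
  1 < b -> 0 < c -> b ^+ j <= c -> j%:Z <= Num.ceil (log_base b c).
Proof.
move=> b1 c0 bc; rewrite -[j%:Z](@intrKceil R); apply: le_ceil.
have lnb : 0 < ln b by rewrite ln_gt0.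
rewrite /log_base ler_pdivlMr// -[j%:~R]/(j%:R) mulr_natl -lnXn; last by lra.
by rewrite ler_ln ?posrE// exprn_gt0//; lra.
Qed.

Lemma inf_le_grad (R : realType) (n : nat) (mu L : R)
    (f1 f2 : 'rV[R]_n -> R) (x : 'rV[R]_n) :
  mu < L -> quad_bounds mu L f1 -> quad_bounds mu L f2 ->
  has_inf (range (fun z => f1 z - f2 z)) ->
  inf (range (fun z => f1 z - f2 z))
    + enorm (grad f1 x - grad f2 x) ^+ 2 / (2 * (L - mu)) <= f1 x - f2 x.
Proof.
move=> muL hf1 hf2 [_ lb]; rewrite enorm_sqr.
have [G GE] : exists G, grad f1 x - grad f2 x = G by eexists.
have g1E : grad f1 x = grad f2 x + G by rewrite -GE addrC subrK.
have Lm0 : L - mu != 0 by apply: lt0r_neq0; lra.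
(* Minimizer of the model of curvature [L - mu] given by the upper bound of [f1] minus the lower
   bound of [f2]. *)
set z := x - (L - mu)^-1 *: G.
have infz : inf (range (fun z => f1 z - f2 z)) <= f1 z - f2 z.
  by apply: ge_inf => //; exists z.
rewrite GE; apply: (le_trans (lerD infz (lexx _))).
have /andP[_ up] := hf1 x z; have /andP[lo _] := hf2 x z.
move: up lo; rewrite (_ : z - x = - ((L - mu)^-1 *: G)); last first.
  by rewrite /z addrC addKr.
rewrite g1E !dotE; clearbody z => up lo.
rewrite (_ : dot G G / (2 * (L - mu)) = (L - mu)^-1 * dot G G
  - (L - mu) / 2 * ((L - mu)^-1 * ((L - mu)^-1 * dot G G))); last by field.
lra.
Qed.

Lemma stepsize_mono (R : realType) (m l m' l' : R) :
  0 < m -> m <= m' -> 0 < l' -> l' <= l ->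
  m / l <= m' / l' /\ stepsize m l <= stepsize m' l'.
Proof.
move=> m0 mm l0 ll.
have kk : m / l <= m' / l'.
  by apply: ler_pM => //; rewrite ?lef_pV2 ?posrE ?invr_ge0; lra.
split=> //; rewrite /stepsize le_min ge_min ler_pM2l// kk /=.
by rewrite ge_min lexx orbT.
Qed.

(** The factor [1 + c] splits as 1/2, paid by the residual [S'] at the new point, and 1/2 + c, paid
    by [S] at the old one. *)
Lemma bdca_test_decrease (R : realType) (F F' S S' l Lb c c' r : R) :
  0 < l -> l <= Lb -> 0 <= S -> 0 <= S' -> 0 < c -> c <= c' ->
  r <= S / Lb -> r <= S' / Lb ->
  F' + (2 * l)^-1 * S' + l^-1 * (2^-1 + c') * S <= F ->
  F' + r * (1 + c) <= F.
Proof.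
move=> l0 lLb S0 S'0 c0 cc r1 r2; rewrite invfM => test.
have V : Lb^-1 <= l^-1 by rewrite lef_pV2 ?posrE; lra.
have V0 : 0 < Lb^-1 by rewrite invr_gt0; lra.
have T1 : r / 2 <= 2^-1 * l^-1 * S'.
  have : Lb^-1 * S' <= l^-1 * S' by rewrite ler_wpM2r.
  lra.
have T2 : r * (2^-1 + c) <= l^-1 * (2^-1 + c') * S.
  apply: (@le_trans _ _ (S / Lb * (2^-1 + c))).
    by rewrite ler_wpM2r//; lra.
  rewrite -mulrA mulrC; apply: ler_wpM2r => //.
  by apply: ler_pM; lra.
lra.
Qed.

Lemma min_grad_rate (R : realType) (n : nat) (f1 f2 : 'rV[R]_n -> R)
    (x : nat -> 'rV[R]_n) (mus Ls : nat -> R) (N : nat) (mu L mb Lb r : R) :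
  0 < mb -> mb <= mu -> mu < L -> L <= Lb ->
  quad_bounds mu L f1 -> quad_bounds mu L f2 ->
  has_inf (range (fun z => f1 z - f2 z)) ->
  (forall k, (1 <= k <= N)%N ->
    [/\ mb <= mus k, 0 < Ls k, Ls k <= Lb &
        bdca_test f1 f2 (x k) (x k.+1) (mus k) (Ls k)]) ->
  (forall k, (1 <= k <= N.+1)%N ->
    r <= enorm (grad f1 (x k) - grad f2 (x k)) ^+ 2 / Lb) ->
  r * ((1 + mb / Lb * stepsize mb Lb) * N%:R + 1 / (2 * (1 - mb / Lb)))
  <= f1 (x 1%N) - f2 (x 1%N) - inf (range (fun z => f1 z - f2 z)).
Proof.
move=> mb0 mbmu muL LLb hf1 hf2 hinf hstep.
pose S k := enorm (grad f1 (x k) - grad f2 (x k)) ^+ 2.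
move=> hr; rewrite -!/(S _) in hr.
have Lb0 : 0 < Lb by lra.
set kp := mb / Lb; set a := stepsize mb Lb.
have S0 k : 0 <= S k by rewrite /S sqr_ge0.
have kp0 : 0 < kp by rewrite divr_gt0.
have a0 : 0 < a by have [] := stepsize_itv mb Lb mb0 Lb0.
have dec k : (1 <= k <= N)%N ->
    f1 (x k.+1) - f2 (x k.+1) + r * (1 + kp * a) <= f1 (x k) - f2 (x k).
  move=> /andP[k1 kN]; have kkN : (1 <= k <= N)%N by rewrite k1.
  have [mbm l0 lLb] := hstep k kkN; rewrite /bdca_test -!/(S _).
  have [kk aa] := stepsize_mono _ _ _ _ _ mb0 mbm l0 lLb.
  have akp : kp * a <= stepsize (mus k) (Ls k) * (mus k / Ls k).
    by rewrite mulrC; apply: ler_pM => //; exact: ltW.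
  apply: (bdca_test_decrease _ _ _ _ _ _ _ _ _ _ l0 lLb (S0 k) (S0 k.+1) _ akp).
  - by rewrite mulr_gt0.
  - by apply: hr; rewrite k1 ltnW.
  - by apply: hr.
have U := inf_le_grad _ _ _ _ _ _ (x N.+1) muL hf1 hf2 hinf.
rewrite -/(S N.+1) in U.
(* Uses [Lb * (1 - kp) = Lb - mb >= L - mu]. *)
have V : r / (2 * (1 - kp)) <= S N.+1 / (2 * (L - mu)).
  have rN : r <= S N.+1 / Lb by apply: hr; rewrite leqnn.
  have SN := S0 N.+1; move: (S N.+1) rN SN => s rN s0.
  have kp1 : 0 < 1 - kp by rewrite subr_gt0 ltr_pdivrMr//; lra.
  apply: (@le_trans _ _ (s / Lb / (2 * (1 - kp)))).
    by rewrite ler_wpM2r ?invr_ge0//; lra.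
  rewrite (_ : s / Lb / (2 * (1 - kp)) = s / (2 * (Lb - mb))).
    by rewrite ler_wpM2l// lef_pV2 ?posrE; lra.
  have kpE : 1 - kp = (Lb - mb) / Lb by rewrite mulrBl divff ?lt0r_neq0.
  rewrite kpE; field; rewrite !lt0r_neq0//; lra.
move: U V; move: (S N.+1) => s U V; clear hr S0.
clearbody kp a => {S}.
have tele k : (k <= N)%N ->
    f1 (x k.+1) - f2 (x k.+1) + r * (1 + kp * a) * k%:R
    <= f1 (x 1%N) - f2 (x 1%N).
  elim: k => [_|k IH kN]; first by rewrite mulr0 addr0.
  by have := IH (ltnW kN); have := dec k.+1 kN; rewrite -[in k.+1%:R]natr1; lra.
have T := tele N (leqnn N).
by rewrite mulrDr mulrA div1r; lra.
Qed.

Theorem theorem3 (R : realType) (n : nat) (mu L : R) (f1 f2 : 'rV[R]_n -> R)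
    (x1 : 'rV[R]_n) (N : nat) (mu0 L0 beta : R) (x : nat -> 'rV[R]_n)
    (hmu : 0 < mu) (hmuL : mu < L)
    (hf1 : smooth_convex mu L f1) (hf2 : smooth_convex mu L f2)
    (hinf : has_inf (range (fun z => f1 z - f2 z)))
    (hN : (1 <= N)%N)
    (hmu0 : 0 < mu0) (hmuL0 : mu0 < L0) (hbeta : 1 < beta)
    (hx : bdca_iterates f1 f2 x1 N mu0 L0 beta x) :
  let f := fun z => f1 z - f2 z in
  let fstar := inf (range f) in
  let Kbar : int :=
    Num.max 0 (Num.max (Num.ceil (log_base beta (beta * L / L0)))
                       (Num.ceil (log_base beta (beta * mu0 / mu)))) in
  let Lbar := beta ^ Kbar * Num.max L0 L in
  let mubar := beta ^ (- Kbar) * Num.min mu0 mu in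
  let alphabar := Num.min (2 * (mubar / Lbar)) 1 in
  let kappabar := mubar / Lbar in
  let r := fun k : nat =>
    enorm (grad f1 (x k) - grad f2 (x k)) ^+ 2 / Lbar in
  \big[Num.min/r 1%N]_(1 <= k < N.+2) r k
    <= (f x1 - fstar)
       / ((1 + kappabar * alphabar) * N%:R + 1 / (2 * (1 - kappabar))).
Proof.
cbv zeta; set Kbar := Num.max 0 _; set Lbar := _ * Num.max L0 L.
set mubar := _ * Num.min mu0 mu; set kappabar := mubar / Lbar.
set alphabar := Num.min (2 * _) 1; set r := fun k => _ / Lbar.
have q1 := smooth_convex_quad_bounds _ _ _ _ _ (ltW hmu) hf1.
have q2 := smooth_convex_quad_bounds _ _ _ _ _ (ltW hmu) hf2.
have [mus [Ls [xE mus0 Ls0 hstep]]] := hx.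
have L_gt0 : 0 < L := lt_trans hmu hmuL.
have L0_gt0 : 0 < L0 := lt_trans hmu0 hmuL0.
have beta0 : 0 < beta := lt_trans ltr01 hbeta.
have [K KE] : exists K : nat, Kbar = K%:Z.
  (* The [0] in the maximum makes [Kbar] a natural number. *)
  by exists `|Kbar|%N; rewrite gez0_abs// /Kbar le_max lexx.
have bK1 : 1 <= beta ^+ K by rewrite exprn_ege1// ltW.
have bK0 : 0 < beta ^+ K := lt_le_trans ltr01 bK1.
have LbarE : Lbar = beta ^+ K * Num.max L0 L by rewrite /Lbar KE.
have mubarE : mubar = Num.min mu0 mu / beta ^+ K.
  by rewrite /mubar KE -exprnN mulrC.
have LLbar : Num.max L0 L <= Lbar by rewrite LbarE ler_peMl// le_max !ltW.
have mubar_mu : mubar <= Num.min mu0 mu.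
  by rewrite mubarE ler_pdivrMr// ler_peMr// le_min !ltW.
have mubar0 : 0 < mubar by rewrite mubarE divr_gt0// lt_min hmu0.
have mubar_le_mu : mubar <= mu.
  by apply: (le_trans mubar_mu); rewrite ge_min lexx orbT.
have L_le_Lbar : L <= Lbar.
  by apply: le_trans LLbar; rewrite le_max lexx orbT.
have Lbar0 : 0 < Lbar := lt_le_trans L_gt0 L_le_Lbar.
have D0 : 0 < (1 + kappabar * alphabar) * N%:R + 1 / (2 * (1 - kappabar)).
  have kappabar0 : 0 < kappabar by rewrite divr_gt0.
  have kappabar1 : 0 < 1 - kappabar.
    by rewrite subr_gt0 ltr_pdivrMr// mul1r; lra.
  have alphabar0 : 0 < alphabar by rewrite lt_min mulr_gt0 ?ltr01.
  apply: addr_gt0; last by rewrite div1r invr_gt0 mulr_gt0.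
  by apply: mulr_gt0; rewrite ?ltr0n// addr_gt0// mulr_gt0.
rewrite ler_pdivlMr//.
have estimates k : (1 <= k <= N)%N ->
    [/\ mubar <= mus k, 0 < Ls k, Ls k <= Lbar &
        bdca_test f1 f2 (x k) (x k.+1) (mus k) (Ls k)].
  move=> /andP[k0 kN].
  have := bdca_estimates_scaling _ _ _ _ _ hmu hmuL hbeta q1 q2
    _ _ _ _ _ _ hmu0 hmuL0 mus0 Ls0 hstep k kN.
  case=> j [mE lE jE test]; have {}test := test k0.
  have bj0 : 0 < beta ^+ j by rewrite exprn_gt0.
  (* Each alternative of [jE] matches a term of the maximum: [j = 0], [beta ^+ j <= beta * L / L0],
     or [beta ^+ j <= beta * mu0 / mu]. *)
  have jK : (j <= K)%N.
    rewrite -lez_nat -KE /Kbar !le_max.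
    case: jE => [->|]; first by rewrite lexx.
    rewrite mE lE => -[jL|jmu]; apply/orP; right; apply/orP; [left|right].
      apply: expr_le_ceil_log; rewrite ?divr_gt0 ?mulr_gt0//.
      by rewrite ler_pdivlMr// ltW.
    apply: expr_le_ceil_log; rewrite ?divr_gt0 ?mulr_gt0//.
    by move: jmu; rewrite mulrA ltr_pdivlMr// ler_pdivlMr// mulrC => /ltW.
  have bjK : beta ^+ j <= beta ^+ K by rewrite ler_weXn2l// ltW.
  split=> //.
  - rewrite mubarE mE; apply: ler_pM.
    + by rewrite le_min !ltW.
    + by rewrite invr_ge0 ltW.
    + by rewrite ge_min lexx.
    + by rewrite lef_pV2 ?posrE.
  - by rewrite lE mulr_gt0.
  - rewrite lE LbarE; apply: ler_pM => //; try exact: ltW.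
    by rewrite le_max lexx.
have hr k : (1 <= k <= N.+1)%N ->
    \big[Num.min/r 1%N]_(1 <= k < N.+2) r k <= r k.
  by move=> kN; apply: ge_bigmin_seq; rewrite ?mem_index_iota.
rewrite -xE.
exact: (min_grad_rate _ _ _ _ _ _ _ _ _ _ _ _ _ mubar0 mubar_le_mu hmuL
  L_le_Lbar q1 q2 hinf estimates hr).
Qed.
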